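(* Let $R$ be a commutative ring and let $\mathcal C$ be a poset that is weakly bounded from above and mub-complete. Let $M$ be an $S$-determined $R\mathcal C$-module, where $S\subseteq\mathcal C$ is a finite subset. Then $\hat{\hat S}$ is a finite support of a presentation (FSP) of $M$, i.e. $\hat{\hat S}$ is a finite set and $M$ is $\hat{\hat S}$-presented.
   Context: A poset $\mathcal C$ is regarded as a category with a unique morphism $c\to d$ iff $c\le d$. An $R\mathcal C$-module is a functor $M\colon\mathcal C\to R\text{-}\mathbf{Mod}$; exactness is pointwise. For $c\in\mathcal C$, ${\downarrow}c=\{d\mid d\le c\}$; for $T\subseteq\mathcal C$, ${\uparrow}T=\{c\mid t\le c\text{ for some }t\in T\}$; $\mathrm{Supp}(M)=\{c\mid M(c)\ne0\}$. $M$ is $S$-determined if $\mathrm{Supp}(M)\subseteq{\uparrow}S$ and for every $c\le d$ in $\mathcal C$, $S\cap{\downarrow}c=S\cap{\downarrow}d$ implies that $M(c\le d)$ is an isomorphism. For $T\subseteq\mathcal C$, $M$ is $T$-presented if the canonical map $\mathrm{colim}_{d\in T,\,d\le c}M(d)\to M(c)$ is an isomorphism for all $c\in\mathcal C$; equivalently, there is an exact sequence $\bigoplus_{s\in T}B_s[\mathrm{Mor}_{\mathcal C}(s,-)]\to\bigoplus_{s\in T}A_s[\mathrm{Mor}_{\mathcal C}(s,-)]\to M\to0$ with $R$-modules $A_s,B_s$, where $A[\mathrm{Mor}_{\mathcal C}(s,-)]=A\otimes_RR[\mathrm{Mor}_{\mathcal C}(s,-)]$ pointwise. If $T$ is finite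 and $M$ is $T$-presented, $T$ is called a finite support of a presentation (FSP) of $M$. $\mathrm{mub}_{\mathcal C}(S)$ is the set of minimal upper bounds of $S$ in $\mathcal C$. For finite $S$, $\hat S=\bigcup_{\emptyset\ne S'\subseteq S}\mathrm{mub}_{\mathcal C}(S')$, and $\hat{\hat S}$ is the result of applying this operation to $\hat S$ (which is finite when $\mathcal C$ is weakly bounded from above). $\mathcal C$ is weakly bounded from above if every finite subset of $\mathcal C$ has a finite number of minimal upper bounds. $\mathcal C$ is mub-complete if for every finite non-empty $S\subseteq\mathcal C$ and every upper bound $c$ of $S$ there is a minimal upper bound $s$ of $S$ with $s\le c$. *)

(* Defs.v *)
From HB Require Import structures.
From mathcomp Require Import all_boot all_order all_algebra.
From mathcomp Require Import boolp classical_sets functions cardinality.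

Set Implicit Arguments.
Unset Strict Implicit.
Unset Printing Implicit Defensive.

Import Order.TTheory GRing.Theory.
Local Open Scope ring_scope.
Local Open Scope classical_set_scope.

Section MinimalUpperBounds.
Context {disp : Order.disp_t} {C : porderType disp}.
Implicit Types (S T : set C) (c : C).

Definition downset c : set C := [set d | (d <= c)%O].
Definition upset T : set C := [set c | exists2 t, T t & (t <= c)%O].

Definition mub S : set C :=
  [set m | ubound S m /\ forall u, ubound S u -> (u <= m)%O -> u = m].

Definition hat S : set C :=
  [set m | exists S' : set C, [/\ S' !=set0, S' `<=` S & mub S' m]].

End MinimalUpperBounds.

(* The empty subset is included: since [mub set0] is the set of minimal elements
   of [C], the latter is required to be finite as well. *)
Definition weakly_bounded_above {disp : Order.disp_t} (C : porderType disp) :=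
  forall S : set C, finite_set S -> finite_set (mub S).

Definition mub_complete {disp : Order.disp_t} (C : porderType disp) :=
  forall S : set C, finite_set S -> S !=set0 ->
  forall c, ubound S c -> exists2 s, mub S s & (s <= c)%O.

(* [comPzRingType] rather than [comNzRingType]: the zero ring is allowed. *)
Record pmodule (R : comPzRingType) (disp : Order.disp_t)
    (C : porderType disp) := PModule {
  pobj :> C -> lmodType R;
  pmap : forall c d : C, (c <= d)%O -> {linear pobj c -> pobj d};
  pmap_id : forall (c : C) (h : (c <= c)%O) (x : pobj c), pmap h x = x;
  pmap_comp : forall (c d e : C) (hcd : (c <= d)%O) (hde : (d <= e)%O)
    (hce : (c <= e)%O) (x : pobj c), pmap hce x = pmap hde (pmap hcd x)
}.

Section Modules.
Context {R : comPzRingType} {disp : Order.disp_t} {C : porderType disp}.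
Implicit Types (M : pmodule R C) (S T D : set C).

Definition Supp M : set C := [set c | exists x : M c, x != 0].

Definition determined S M : Prop :=
  Supp M `<=` upset S /\
  forall (c d : C) (h : (c <= d)%O),
    S `&` downset c = S `&` downset d -> bijective (pmap M h).

(* Cocones with vertex [L] under the restriction of [M] to the full subposet
   [D]. *)
Definition cocone M D (L : lmodType R)
    (i : forall d : D, {linear M (val d) -> L}) : Prop :=
  forall (d e : D) (h : (val d <= val e)%O) (x : M (val d)),
    i e (pmap M h x) = i d x.

Definition is_colimit M D (L : lmodType R)
    (i : forall d : D, {linear M (val d) -> L}) : Prop :=
  cocone i /\
  forall (N : lmodType R) (f : forall d : D, {linear M (val d) -> N}),
    cocone f ->
    exists2 g : {linear L -> N},
      (forall d x, g (i d x) = f d x) &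
      forall g' : {linear L -> N},
        (forall d x, g' (i d x) = f d x) -> g' =1 g.

(* [k] is the canonical map out of a colimit [(L, i)] over the elements of [T]
   below [c]. *)
Definition presented T M : Prop :=
  forall c : C,
    exists (L : lmodType R)
           (i : forall d : T `&` downset c, {linear M (val d) -> L})
           (k : {linear L -> M c}),
      [/\ is_colimit i,
          forall (d : T `&` downset c) (h : (val d <= c)%O) (x : M (val d)),
            k (i d x) = pmap M h x
        & bijective k].

Definition FSP T M : Prop := finite_set T /\ presented T M.

(* The choice of the colimit in [presented] is immaterial. *)
Lemma presented_any T M : presented T M ->
  forall (c : C) (L : lmodType R)
    (i : forall d : T `&` downset c, {linear M (val d) -> L})
    (k : {linear L -> M c}),
    is_colimit i ->
    (forall (d : T `&` downset c) (h : (val d <= c)%O) (x : M (val d)),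
       k (i d x) = pmap M h x) ->
    bijective k.
Proof.
move=> TM c L i k [ci ui] ki; have [L' [i' [k' [[ci' ui'] ki' bk']]]] := TM c.
have [f fi _] := ui L' i' ci'; have [g gi _] := ui' L i ci.
have le (d : T `&` downset c) : (val d <= c)%O by have /set_mem[] := valP d.
have gf : cancel f g.
  have [h _ hu] := ui L i ci => y.
  have e : (g \o f) y = h y by apply: hu => d x /=; rewrite fi gi.
  by rewrite -/((g \o f) y) e -(hu idfun).
have fg : cancel g f.
  have [h _ hu] := ui' L' i' ci' => y.
  have e : (f \o g) y = h y by apply: hu => d x /=; rewrite gi fi.
  by rewrite -/((f \o g) y) e -(hu idfun).
have bkf := bij_comp bk' (Bijective gf fg); apply: (eq_bij bkf) => y /=.
have cM : cocone (fun d : T `&` downset c => pmap M (le d)).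
  by move=> d e h x; rewrite -pmap_comp.
have [h _ hu] := ui (M c) _ cM.
have e : (k' \o f) y = h y by apply: hu => d x /=; rewrite fi ki'.
by rewrite -/((k' \o f) y) e -(hu k) // => d x; rewrite ki.
Qed.

End Modules.

(* Main.v *)
(** The colimit over [hat (hat S)] below [c] can be computed as [M c] itself.
    If [m <= c] is a minimal upper bound of [S `&` downset c], then [m] and [c]
    lie above the same elements of [S], so [M m -> M c] is an isomorphism; hence
    a cocone over [hat (hat S)] below [c] can only factor through [M c] via its
    component at [m].  The cocone is determined by its components at points of
    [hat S], and the component at [m'] in [hat S] is compared with the one at [m]
    through a minimal upper bound of [m] and [m'] below [c], which belongs to
    [hat (hat S)]. *)

From HB Require Import structures.
From mathcomp Require Import all_boot all_order all_algebra.
From mathcomp Require Import finmap.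
From mathcomp Require Import boolp classical_sets functions cardinality.
Require Import Defs.

Set Implicit Arguments.
Unset Strict Implicit.
Unset Printing Implicit Defensive.

Import Order.TTheory GRing.Theory.
Local Open Scope ring_scope.
Local Open Scope classical_set_scope.

Lemma finite_set_subsets (T : choiceType) (S : set T) :
  finite_set S -> finite_set [set A | A `<=` S].
Proof.
move=> fS.
have := finite_image (fun B : {fset T} => [set` B])
  (finite_fset (fpowerset (fset_set S))).
apply: sub_finite_set => A AS.
have fA : finite_set A := sub_finite_set AS fS.
exists (fset_set A); last by rewrite fset_setK.
by rewrite /= fpowersetE -fset_set_sub.
Qed.

Lemma bijective_linear (R : comPzRingType) (U V : lmodType R)
    (f : {linear U -> V}) :
  bijective f -> exists g : {linear V -> U}, cancel f g /\ cancel g f.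
Proof.
case=> f' ff' f'f.
pose fL := GRing.isLinear.Build R V U *:%R f' (GRing.can2_linear ff' f'f).
by exists (HB.pack_for {linear V -> U} f' fL).
Qed.

Section Hat.
Context {disp : Order.disp_t} {C : porderType disp}.
Implicit Types (S : set C) (c d e m : C).

Lemma hat_finite S :
  weakly_bounded_above C -> finite_set S -> finite_set (hat S).
Proof.
move=> wb fS.
have : finite_set (\bigcup_(A in [set A | A `<=` S]) mub A).
  apply: bigcup_finite => [|A AS]; first exact: finite_set_subsets.
  exact/wb/(sub_finite_set AS fS).
by apply: sub_finite_set => m [A [_ AS mA]]; exists A.
Qed.

Lemma sub_hat S : S `<=` hat S.
Proof.
move=> s Ss; exists [set s]; split; [by exists s | by move=> _ -> | split].
  by move=> _ ->.
by move=> u us us'; apply/eqP; rewrite eq_le us' us.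
Qed.

Lemma hat_upset S : hat S `<=` upset S.
Proof.
by move=> m [A [[a Aa] AS [mA _]]]; exists a; [exact: AS | exact: mA].
Qed.

Lemma upset_hat S : upset (hat S) = upset S.
Proof.
apply/seteqP; split=> c [t St tc]; last by exists t => //; exact: sub_hat.
by have [s Ss st] := hat_upset St; exists s => //; exact: le_trans tc.
Qed.

(** Feeds [determined]: all maps of a determined module between points of the interval from [m] to
    [c] are isomorphisms. *)
Lemma downset_between S m d c : S `&` downset c `<=` downset m ->
  (m <= d)%O -> (d <= c)%O -> S `&` downset d = S `&` downset c.
Proof.
move=> cm md dc; apply/seteqP; split=> s [Ss sd]; split=> //.
  exact: le_trans dc.
by apply: le_trans md; exact: cm.
Qed.

(** Take a minimal upper bound of the elements of [S] below [c]; there is at least one such element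
    since [c] lies in [upset S]. *)
Lemma upset_hat_below S c : mub_complete C -> finite_set S -> upset S c ->
  exists m, [/\ hat S m, (m <= c)%O & S `&` downset c `<=` downset m].
Proof.
move=> mc fS [s Ss sc].
have [|||m mm le_mc] := mc (S `&` downset c) _ _ c.
- exact: sub_finite_set fS.
- by exists s.
- by move=> ? [].
exists m; split=> //; last exact: mm.1.
by exists (S `&` downset c); split=> //; exists s.
Qed.

Lemma hat_pair S c d e : mub_complete C -> S d -> S e ->
  (d <= c)%O -> (e <= c)%O ->
  exists u, [/\ hat S u, (d <= u)%O, (e <= u)%O & (u <= c)%O].
Proof.
move=> mc Sd Se dc ec.
have [|||u uu uc] := mc [set d; e] _ _ c.
- exact: finite_set2.
- by exists d; left.
- by move=> ? [] ->.
exists u; split=> //; [|by apply: uu.1; left|by apply: uu.1; right].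
by exists [set d; e]; split=> //; [exists d; left | move=> ? [] ->].
Qed.

End Hat.

Theorem corollary4p13 (R : comPzRingType) (disp : Order.disp_t)
    (C : porderType disp) (S : set C) (M : pmodule R C) :
  weakly_bounded_above C -> mub_complete C ->
  finite_set S -> determined S M ->
  FSP (hat (hat S)) M.
Proof.
move=> wb mc fS [supp iso].
split; first exact: hat_finite wb (hat_finite wb fS).
move=> c; set T := hat (hat S).
have le (d : T `&` downset c) : (val d <= c)%O by have /set_mem[] := valP d.
exists (M c), (fun d => pmap M (le d)), idfun; split; last 2 first.
- by move=> d h x; rewrite /= (Prop_irrelevance h (le d)).
- by exists idfun.
split=> [d e h x|N f cf]; first by rewrite -pmap_comp.
(* Outside [upset S], [M c] is zero and no element of [T] lies below [c], so the zero map
   mediates. *)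
have [Sc|nSc] := pselect (upset S c); last first.
  have Mc0 (x : M c) : x = 0.
    by apply/eqP/negPn/negP => x0; apply/nSc/supp; exists x.
  exists (\0 : {linear M c -> N}) => [d x|g' _ x]; last first.
    by rewrite (Mc0 x) !linear0.
  have /set_mem[Td _] := valP d; case: nSc.
  by rewrite -upset_hat -upset_hat; exists (val d).
have below d : hat S d -> (d <= c)%O -> d \in T `&` downset c.
  by move=> Sd dc; apply/mem_set; split=> //; exact: sub_hat.
have [m [Sm le_mc cm]] := upset_hat_below mc fS Sc.
have [p [mp pm]] := bijective_linear
  (iso _ _ le_mc (downset_between cm (lexx m) le_mc)).
pose mT : T `&` downset c := exist _ m (below m Sm le_mc).
pose fm : {linear M m -> N} := f mT.
(* Since [m] is itself an index, the cocone condition at [m] forces this formula. *)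
exists (fm \o p : {linear M c -> N}) => [d|g' g'f x]; last first.
  rewrite /= /fm -g'f -{1}(pm x); congr (g' _).
  by rewrite (Prop_irrelevance le_mc (le mT)).
have /set_mem[Td dc] := valP d.
have Sd : upset S (val d) by rewrite -upset_hat -upset_hat; exists (val d).
(* A minimal upper bound of [m] and [val d] might leave [T]; the isomorphism from [M m'] to
   [M (val d)] moves the check to [m'] in [hat S]. *)
have [m' [Sm' le_m'd dm']] := upset_hat_below mc fS Sd.
have [q mq qm] := iso _ _ le_m'd (downset_between dm' (lexx m') le_m'd).
have le_m'c := le_trans le_m'd dc.
have [e [Te le_me le_m'e le_ec]] := hat_pair mc Sm Sm' le_mc le_m'c.
have eT : e \in T `&` downset c by apply/mem_set.
have [r mr rm] := iso _ _ le_me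
  (etrans (downset_between cm (lexx m) le_mc)
          (esym (downset_between cm le_me le_ec))).
move=> x; rewrite -(qm x); set x' := q x.
pose d' : T `&` downset c := exist _ m' (below m' Sm' le_m'c).
pose e' : T `&` downset c := exist _ e eT.
(* [y] in [M m] has the same image in [M e] as [x'], hence the same image in [M c] and, by the
   cocone relations at [e], the same value in [N]. *)
pose y := r (pmap M le_m'e x').
have yE : pmap M le_me y = pmap M le_m'e x' by rewrite /y rm.
have -> : pmap M (le d) (pmap M le_m'd x') = pmap M le_mc y.
  by rewrite -(pmap_comp _ _ le_m'c) (pmap_comp le_m'e le_ec) -yE -pmap_comp.
rewrite /= mp (cf d' d) -(cf d' e' le_m'e) -yE.
by rewrite /fm -(cf mT e' le_me).
Qed.
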